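(* Let $\alpha,\beta\in\mathbb{N}^{\ast}$, $n\in\mathbb{N}^{\ast}$ and $x\in\mathbb{Z}_p$. Then \[ g_{n+1,q^{-1}}^{(\alpha,\beta)}(1-x)=(-1)^{n}q^{\alpha n-\beta}\,g_{n+1,q}^{(\alpha,\beta)}(x). \]
   Context: Let $p$ be a fixed odd prime, $\mathbb{Z}_p$ the ring of $p$-adic integers, $\mathbb{C}_p$ the completion of an algebraic closure of $\mathbb{Q}_p$, and $q\in\mathbb{C}_p$ with $|q-1|_p<1$. $\mathbb{N}^{\ast}=\{0,1,2,\dots\}$. The $q$-number is $[x]_q=\frac{1-q^x}{1-q}$. For a uniformly differentiable function $f$ on $\mathbb{Z}_p$, the fermionic $p$-adic $q$-integral is \[ \int_{\mathbb{Z}_p}f(\xi)\,d\mu_{-q}(\xi)=\lim_{N\to\infty}\frac{1}{[p^N]_{-q}}\sum_{\xi=0}^{p^N-1}q^{\xi}f(\xi)(-1)^{\xi}, \] and $d\mu_{-q^{\gamma}}$ denotes the same with $q$ replaced by $q^{\gamma}$. The modified $q$-Genocchi polynomials with weight $\alpha$ and $\beta$ are defined for $n\in\mathbb{N}^{\ast}$ by \[ \frac{g_{n+1,q}^{(\alpha,\beta)}(x)}{n+1}=\int_{\mathbb{Z}_p}q^{-\beta\xi}[x+\xi]_{q^{\alpha}}^{n}\,d\mu_{-q^{\beta}}(\xi), \] with $g_{0,q}^{(\alpha,\beta)}=0$. The symbol $g_{n,q^{-1}}^{(\alpha,\beta)}(x)$ denotes the same object with $q$ replaced by $q^{-1}$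 throughout, i.e. $\frac{g_{n+1,q^{-1}}^{(\alpha,\beta)}(x)}{n+1}=\int_{\mathbb{Z}_p}q^{\beta\xi}[x+\xi]_{q^{-\alpha}}^{n}\,d\mu_{-q^{-\beta}}(\xi)$. *)

(* Defs.v *)
From HB Require Import structures.
From mathcomp Require Import all_boot all_order all_algebra.
From mathcomp Require Import all_classical all_reals all_analysis.

Set Implicit Arguments.
Unset Strict Implicit.
Unset Printing Implicit Defensive.

Import Order.TTheory GRing.Theory Num.Theory.
Import numFieldNormedType.Exports.
Local Open Scope classical_set_scope.
Local Open Scope ring_scope.

Section ValuedField.
Context {R : realType} {C : fieldType} (abs : C -> R).

Definition ultrametric_abs : Prop :=
  [/\ forall x, 0 <= abs x,
      forall x, abs x = 0 <-> x = 0,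
      forall x y, abs (x * y) = abs x * abs y
    & forall x y, abs (x + y) <= Num.max (abs x) (abs y)].

Definition acvg (u : nat -> C) (l : C) : Prop :=
  abs (u n - l) @[n --> \oo] --> (0 : R).

Definition acauchy (u : nat -> C) : Prop :=
  forall e : R, 0 < e -> exists N : nat,
    forall m n : nat, (N <= m)%N -> (N <= n)%N -> abs (u m - u n) < e.

(* Equal to 0 when [u] does not converge. *)
Definition alim (u : nat -> C) : C := xget 0 [set l | acvg u l].

Definition adense_in (A B : set C) : Prop :=
  forall z, B z -> forall e : R, 0 < e -> exists2 y, A y & abs (z - y) < e.

(* The topological closure of the prime field. In a complete field whose
   absolute value extends the p-adic one, this is the completion Q_p of Q. *)
Definition padic_num : set C :=
  [set x | forall e : R, 0 < e -> exists r : rat, abs (x - ratr r) < e].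

Definition padic_int : set C := [set x | padic_num x /\ abs x <= 1].

Definition padic_alg : set C :=
  [set z | exists P : {poly C},
    [/\ P != 0, forall i, padic_num P`_i & root P z]].

(* [C], with [abs], is the completion of an algebraic closure of Q_p. A
   multiplicative ultrametric [abs] with |p| = 1/p restricts to the normalized
   p-adic absolute value on Q, so these conditions determine [(C, abs)] up to
   isometric isomorphism. *)
Record is_Cp (p : nat) : Prop := IsCp {
  Cp_abs : ultrametric_abs;
  Cp_abs_p : abs p%:R = p%:R^-1;
  Cp_complete : forall u : nat -> C, acauchy u -> exists l, acvg u l;
  Cp_closure : forall P : {poly C}, (1 < size P)%N ->
    (forall i, padic_alg P`_i) -> exists2 z, padic_alg z & root P z;
  Cp_dense : adense_in padic_alg setT
}.

(* The power a^x for |a - 1| < 1 and x in Z_p: the value at x of the continuous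
   extension of n |-> a^n from the natural numbers, dense in Z_p, to Z_p. *)
Definition apow (a x : C) : C :=
  xget 0 [set l | forall e : R, 0 < e -> exists2 d : R, 0 < d &
    forall n : nat, abs (n%:R - x) < d -> abs (a ^+ n - l) < e].

(* The q-number [x]_a for x in Z_p and |a - 1| < 1, with the usual convention
   [x]_1 = x, needed at a = q^0. *)
Definition qnum (a x : C) : C :=
  if a == 1 then x else (1 - apow a x) / (1 - a).

(* The q-number [m]_a for a natural number m and a != 1. It is separate from
   [qnum] because it is used at base a = -q, where m |-> a^m has no continuous
   extension to Z_p. *)
Definition qnumn (a : C) (m : nat) : C := (1 - a ^+ m) / (1 - a).

(* The fermionic p-adic q-integral of f over Z_p; only the values of f at
   natural numbers matter. *)
Definition fermionic_int (p : nat) (q : C) (f : C -> C) : C :=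
  alim (fun N => (qnumn (- q) (p ^ N))^-1 *
    \sum_(0 <= k < p ^ N) q ^+ k * f k%:R * (-1) ^+ k).

Definition genocchi (p : nat) (q : C) (alpha beta n : nat) (x : C) : C :=
  if n is m.+1 then
    m.+1%:R * fermionic_int p (q ^+ beta)
      (fun xi => apow q (- (beta%:R * xi)) * qnum (q ^+ alpha) (x + xi) ^+ m)
  else 0.

End ValuedField.

(* Main.v *)
(* At natural numbers xi the weight q^(-beta xi) cancels the density q^(beta xi),
   so, writing a = q^alpha, the integral of index N is an alternating sum of
   [x + k]_a^n over k < p^N, divided by [p^N]_{-q^beta}. Since
   [y]_{1/a} = -a [-y]_a, the change of index k -> p^N - 1 - k (p^N is odd)
   turns the sum for 1/q and 1 - x into (-a)^n times the sum for q and x - p^N.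
   As [p^N]_a -> 0, q^(beta p^N) -> 1 and |[p^N]_{-q^beta}| = 1, the two sequences
   differ, up to the factor of the theorem, by a null sequence; hence their limits
   agree up to that factor, whether or not they exist. *)

Require Import Defs.
From HB Require Import structures.
From mathcomp Require Import all_boot all_order all_algebra.
From mathcomp Require Import all_classical all_reals all_analysis.
From mathcomp Require Import ring.
Import Order.TTheory GRing.Theory Num.Theory.
Import numFieldNormedType.Exports.
Local Open Scope ring_scope.

Set Implicit Arguments.
Unset Strict Implicit.

(** * Ultrametric absolute values and limits *)

Section Ultrametric.
Context {R : realType} {C : fieldType} {abs : C -> R}.
Context (habs : ultrametric_abs abs).

Lemma abs_ge0 x : 0 <= abs x.
Proof. by case: habs. Qed.

Lemma abs_eq0 x : (abs x == 0) = (x == 0).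
Proof. by case: habs => _ h _ _; apply/eqP/eqP => /h. Qed.

Lemma abs0 : abs 0 = 0.
Proof. by apply/eqP; rewrite abs_eq0. Qed.

Lemma abs_gt0 x : (0 < abs x) = (x != 0).
Proof. by rewrite lt_neqAle abs_ge0 andbT eq_sym abs_eq0. Qed.

Lemma absM x y : abs (x * y) = abs x * abs y.
Proof. by case: habs. Qed.

Lemma abs1 : abs 1 = 1.
Proof.
apply: (mulfI (x := abs 1)); first by rewrite abs_eq0 oner_eq0.
by rewrite -absM !mulr1.
Qed.

Lemma absX x n : abs (x ^+ n) = abs x ^+ n.
Proof. by elim: n => [|n IH]; rewrite ?expr0 ?abs1 // !exprS absM IH. Qed.

Lemma absN x : abs (- x) = abs x.
Proof.
suff h : abs (- 1) = 1 by rewrite -mulN1r absM h mul1r.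
by apply/eqP; rewrite -(@pexpr_eq1 _ _ 2) ?abs_ge0 // -absX sqrrN expr1n abs1.
Qed.

Lemma absB x y : abs (x - y) = abs (y - x).
Proof. by rewrite -absN opprB. Qed.

Lemma absV x : abs x^-1 = (abs x)^-1.
Proof.
have [->|x0] := eqVneq x 0; first by rewrite invr0 abs0 invr0.
apply: (mulfI (x := abs x)); first by rewrite abs_eq0.
by rewrite -absM !divff ?abs1 ?abs_eq0.
Qed.

Lemma abs_sign x n : abs ((-1) ^+ n * x) = abs x.
Proof. by rewrite absM absX absN abs1 expr1n mul1r. Qed.

Lemma absD_le x y e : abs x <= e -> abs y <= e -> abs (x + y) <= e.
Proof.
case: habs => _ _ _ h xe ye; apply: le_trans (h x y) _.
by rewrite ge_max xe.
Qed.

Lemma absD_lt x y e : abs x < e -> abs y < e -> abs (x + y) < e.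
Proof.
case: habs => _ _ _ h xe ye; apply: le_lt_trans (h x y) _.
by rewrite gt_max xe.
Qed.

Lemma abs_dist_lt y x z e : abs (x - y) < e -> abs (y - z) < e -> abs (x - z) < e.
Proof. by move=> xy yz; rewrite -(subrKA y); exact: absD_lt. Qed.

Lemma absM_le1 x y : abs x <= 1 -> abs y <= 1 -> abs (x * y) <= 1.
Proof. by move=> x1 y1; rewrite absM mulr_ile1 ?abs_ge0. Qed.

Lemma absX_le1 x n : abs x <= 1 -> abs (x ^+ n) <= 1.
Proof. by move=> x1; rewrite absX exprn_ile1 ?abs_ge0. Qed.

Lemma abs_sum_le (I : Type) (r : seq I) (P : pred I) (F : I -> C) e :
  0 <= e -> (forall i, P i -> abs (F i) <= e) -> abs (\sum_(i <- r | P i) F i) <= e.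
Proof.
move=> e0 h; elim/big_ind: _ => //; first by rewrite abs0.
by move=> x y; exact: absD_le.
Qed.

Lemma abs_nat_le1 n : abs n%:R <= 1.
Proof. by elim: n => [|n IH]; rewrite ?abs0 // -natr1 absD_le ?abs1. Qed.

(** The cofactor of [x - y] in [x ^+ n - y ^+ n] is a sum of products of elements of the unit ball,
    so the ultrametric inequality bounds it by 1. *)
Lemma abs_subXX_le x y n : abs x <= 1 -> abs y <= 1 ->
  abs (x ^+ n - y ^+ n) <= abs (x - y).
Proof.
move=> x1 y1; rewrite subrXX absM ler_piMr ?abs_ge0 //.
by apply: abs_sum_le => // i _; rewrite absM_le1 ?absX_le1.
Qed.

(** If [abs a < 1], then [1 = a - (a - 1)] would also have absolute value below 1. *)
Lemma abs_eq1 a : abs (a - 1) < 1 -> abs a = 1.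
Proof.
move=> h; apply/le_anti/andP; split.
  by rewrite -[a](subrK 1) absD_le ?abs1 // ltW.
rewrite leNgt; apply/negP => a1.
have : abs (a - (a - 1)) < 1 by rewrite absD_lt ?absN.
by rewrite subKr abs1 ltxx.
Qed.

Lemma abs_subX1_le a n : abs (a - 1) < 1 -> abs (a ^+ n - 1) <= abs (a - 1).
Proof.
by move=> /abs_eq1 h; rewrite -[in X in abs X](expr1n _ n) abs_subXX_le ?abs1 ?h.
Qed.

Lemma abs_subV1 a : abs (a - 1) < 1 -> abs (a^-1 - 1) = abs (a - 1).
Proof.
move=> /abs_eq1 h; have a0 : a != 0 by rewrite -abs_gt0 h.
have -> : a^-1 - 1 = (1 - a) / a by rewrite mulrBl divff // mul1r.
by rewrite absM absV h invr1 mulr1 absB.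
Qed.

Lemma acvgP u l : acvg abs u l <->
  forall e, 0 < e -> exists N, forall n, (N <= n)%N -> abs (u n - l) < e.
Proof.
rewrite /acvg cvgr0Pnorm_lt; split=> h e /h => [[N _ hN]|[N hN]].
  by exists N => n /hN; rewrite /= ger0_norm ?abs_ge0.
by exists N => // n /hN; rewrite /= ger0_norm ?abs_ge0.
Qed.

Lemma abs_lt_eq0 x : (forall e, 0 < e -> abs x < e) -> x = 0.
Proof.
move=> h; apply/eqP; rewrite -abs_eq0 -[_ == _]negbK; apply/negP => x0.
by have := h (abs x); rewrite ltxx lt_neqAle eq_sym x0 abs_ge0 => /(_ isT).
Qed.

Lemma acvg_unique u l l' : acvg abs u l -> acvg abs u l' -> l = l'.
Proof.
move=> /acvgP h /acvgP h'; apply/eqP; rewrite -subr_eq0; apply/eqP.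
apply: abs_lt_eq0 => e e0; have [N hN] := h _ e0; have [M hM] := h' _ e0.
apply: (@abs_dist_lt (u (maxn N M))); last by rewrite hM // leq_maxr.
by rewrite absB hN // leq_maxl.
Qed.

Lemma alimP u l : acvg abs u l -> alim abs u = l.
Proof. by move=> ul; apply: xget_unique => // l' ul'; exact: acvg_unique ul' ul. Qed.

Lemma acvg_scale {u v c l} : acvg abs (fun n => u n - c * v n) 0 ->
  acvg abs v l -> acvg abs u (c * l).
Proof.
move=> /acvgP huv /acvgP hv; apply/acvgP => e e0.
(* The tolerance for [v] is [e / abs c], so [c = 0] is treated apart. *)
have [c0|c0] := eqVneq c 0.
  have [N hN] := huv _ e0; exists N => n /hN.
  by rewrite c0 !mul0r !subr0.
have [N hN] := huv _ e0.
have [M hM] := hv (e / abs c) (divr_gt0 e0 (etrans (abs_gt0 c) c0)).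
exists (maxn N M) => n; rewrite geq_max => /andP[/hN + /hM].
rewrite subr0 ltr_pdivlMr ?abs_gt0 // [_ * abs c]mulrC -absM mulrBr => h1 h2.
exact: abs_dist_lt h1 h2.
Qed.

(* Holds without convergence, since [alim] is 0 on divergent sequences. *)
Lemma alim_scale u v c : c != 0 -> acvg abs (fun n => u n - c * v n) 0 ->
  alim abs u = c * alim abs v.
Proof.
move=> c0 huv; have [[l vl]|hv] := pselect (exists l, acvg abs v l).
  by rewrite (alimP vl); apply: alimP; exact: acvg_scale huv vl.
rewrite /alim [in RHS]xgetPN ?mulr0; last by move=> l vl; apply: hv; exists l.
(* A limit of [u] would give one of [v], because [v - c^-1 * u] is null too. *)
rewrite xgetPN // => l ul; apply: hv; exists (c^-1 * l); apply: acvg_scale ul.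
move: huv => /acvgP huv; apply/acvgP => e e0.
have [N hN] := huv (e * abs c) (mulr_gt0 e0 (etrans (abs_gt0 c) c0)).
exists N => n /hN; rewrite !subr0 -ltr_pdivrMr ?abs_gt0 // [_ / abs c]mulrC -absV -absM.
by rewrite mulrBr mulKf // absB.
Qed.

End Ultrametric.

(* [x] lies in the closure of the natural numbers, that is, in Z_p. Unlike for
   [padic_int], closure under the ring operations needs no arithmetic of [ratr]. *)
Definition nat_adherent {R : realType} {C : fieldType} (abs : C -> R) (x : C) :=
  forall e, 0 < e -> exists n : nat, abs (n%:R - x) < e.

(** * Absolute values of integers, and Z_p as the closure of the natural numbers *)

Section Padic.
Context {R : realType} {C : fieldType} {abs : C -> R} {p : nat}.
Context (habs : ultrametric_abs abs) (p_prime : prime p).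
Context (abs_p : abs p%:R = p%:R^-1).

Lemma abs_p_lt1 : abs p%:R < 1.
Proof. by rewrite abs_p invf_lt1 ?ltr1n ?ltr0n ?prime_gt1 ?prime_gt0. Qed.

Lemma abs_pX_lt e : 0 < e -> exists N, forall n, (N <= n)%N -> abs (p ^ n)%:R < e.
Proof.
move=> e0; have hp : `|abs p%:R| < 1 by rewrite ger0_norm ?abs_ge0 // abs_p_lt1.
have /cvgr0Pnorm_lt /(_ e e0) [N _ hN] := cvg_expr hp.
by exists N => n /hN; rewrite /= natrX absX // ger0_norm // exprn_ge0 // abs_ge0.
Qed.

Lemma abs_nat_mul_lt k m e : abs m%:R < e -> abs (k * m)%N%:R < e.
Proof.
move=> me; apply: le_lt_trans me; rewrite natrM absM // ler_piMl ?abs_ge0 //.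
exact: abs_nat_le1.
Qed.

(** Bezout writes 1 as [k * p - a * m]; if [abs m%:R < 1], both terms would lie in the open unit
    ball. *)
Lemma abs_coprime m : coprime p m -> abs m%:R = 1.
Proof.
move=> /eqP pm; apply/le_anti; rewrite abs_nat_le1 //= leNgt; apply/negP => m1.
have [a _] := Bezoutl m (prime_gt0 p_prime).
rewrite pm => /dvdnP[k hk].
have : abs ((k * p)%N%:R - (a * m)%N%:R) < 1.
  by rewrite absD_lt ?absN ?abs_nat_mul_lt ?abs_p_lt1.
by rewrite -hk natrD addrK abs1 // ltxx.
Qed.

(** For nonzero [k] of p-adic valuation v, [abs k%:R] is the v-th power of [abs p%:R < 1], so the
    hypothesis bounds v from below by [N]. *)
Lemma dvd_of_abs_lt k N : abs k%:R < abs (p ^ N)%:R -> (p ^ N %| k)%N.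
Proof.
case: k => [|k]; first by rewrite dvdn0.
have [m pm hk] := pfactor_coprime p_prime (ltn0Sn k).
rewrite {1}hk natrM absM // abs_coprime // mul1r !natrX !absX //.
rewrite ltr_iXn2l ?abs_p_lt1 //; last by rewrite abs_p invr_gt0 ltr0n prime_gt0.
by move=> /ltnW hN; rewrite pfactor_dvdn.
Qed.

Lemma abs_int_absz (z : int) : abs z%:~R = abs `|z|%N%:R.
Proof. by case: z => n //=; rewrite NegzE mulrNz absN. Qed.

Lemma abs_nat_gt0 n : (0 < n)%N -> 0 < abs n%:R.
Proof.
move=> n0; have [m pm ->] := pfactor_coprime p_prime n0.
rewrite natrM absM // abs_coprime // mul1r natrX absX // exprn_gt0 //.
by rewrite abs_p invr_gt0 ltr0n prime_gt0.
Qed.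

(** Write [r = a / d] in lowest terms; [p] does not divide [d]. The Chinese remainder theorem then
    gives a multiple [n * d] of [d] congruent to [a] modulo [p ^ N], and [abs d%:R = 1] lets one
    divide by [d]. *)
Lemma ratr_nat_approx (r : rat) N : abs (ratr r) <= 1 ->
  exists n : nat, abs (n%:R - ratr r) <= abs (p ^ N)%:R.
Proof.
rewrite /ratr; set a := numq r; have [d hd d0] : exists2 d : nat, denq r = d & (0 < d)%N.
  by exists `|denq r|%N; rewrite ?absz_gt0 ?denq_neq0 // gez0_abs ?denq_ge0.
have := coprime_num_den r; rewrite hd absz_nat -/a => ad h.
have pd : coprime p d.
  (* If [p] divided [d], it would be prime to [a], and [abs (ratr r)] would be the inverse of
     [abs d%:R < 1]. *)
  rewrite prime_coprime //; apply/negP => pd.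
  have pa : coprime p `|a| by apply: coprime_dvdl pd _; rewrite coprime_sym.
  move: h; rewrite absM // abs_int_absz abs_coprime // mul1r absV // leNgt.
  rewrite invf_gt1 ?abs_nat_gt0 // => /negP; apply.
  by case/dvdnP: pd => k ->; rewrite abs_nat_mul_lt ?abs_p_lt1.
have d1 : abs d%:R = 1 by exact: abs_coprime.
have dC : d%:R != 0 :> C by rewrite -(abs_gt0 habs) d1.
have dP : coprime d (p ^ N) by rewrite coprime_sym coprimeXl.
set c := chinese d (p ^ N) 0 `|(a %% (p ^ N)%N)%Z|.
have /dvdnP[n cn] : (d %| c)%N by rewrite /dvdn chinese_modl // mod0n.
have : (c%:Z == a %[mod (p ^ N)%N])%Z.
  rewrite modz_nat chinese_modr // -modz_nat gez0_abs ?modz_mod //.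
  by rewrite modz_ge0 // gt_eqF // ltz_nat expn_gt0 prime_gt0.
rewrite eqz_mod_dvd => /dvdzP[z hz].
exists n; rewrite -[n%:R](mulfK dC) -mulrBl absM // absV // d1 invr1 mulr1.
have -> : n%:R * d%:R - a%:~R = (z * (p ^ N)%N)%:~R :> C.
  by rewrite -hz cn rmorphB /= -natrM.
rewrite rmorphM /= absM // ler_piMl ?abs_ge0 // abs_int_absz.
exact: abs_nat_le1.
Qed.

Lemma padic_int_nat_adherent x : padic_int abs x -> nat_adherent abs x.
Proof.
move=> [xQ x1] e e0; have [N /(_ N (leqnn N)) hN] := abs_pX_lt e0.
(* The bound 1 keeps the rational approximation [r] in the unit ball. *)
have e1 : 0 < Order.min e 1 by rewrite lt_min e0 ltr01.
have [r] := xQ _ e1.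
rewrite lt_min => /andP[xr /ltW xr1].
have [|n hn] := @ratr_nat_approx r N.
  by rewrite -[ratr r](subKr x) absD_le ?absN.
by exists n; apply: abs_dist_lt (le_lt_trans hn hN) _; rewrite // absB.
Qed.

Lemma nat_adherent_nat n : nat_adherent abs n%:R.
Proof. by move=> e e0; exists n; rewrite subrr abs0. Qed.

Lemma nat_adherentD x y :
  nat_adherent abs x -> nat_adherent abs y -> nat_adherent abs (x + y).
Proof.
move=> hx hy e e0; have [n hn] := hx _ e0; have [m hm] := hy _ e0.
by exists (n + m)%N; rewrite natrD opprD addrACA absD_lt.
Qed.

(* [- n] is the limit of the natural numbers [n * (p ^ N - 1)]. *)
Lemma nat_adherentN x : nat_adherent abs x -> nat_adherent abs (- x).
Proof.
move=> hx e e0; have [n hn] := hx _ e0.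
have [N /(_ N (leqnn N)) hN] := abs_pX_lt e0.
have p1 : (0 < p ^ N)%N by rewrite expn_gt0 prime_gt0.
exists (n * (p ^ N).-1)%N.
have -> : (n * (p ^ N).-1)%N%:R - - x = (n * p ^ N)%N%:R - (n%:R - x).
  by rewrite -[in (n * p ^ N)%N](prednK p1) mulnS natrD; ring.
by rewrite absD_lt ?absN ?abs_nat_mul_lt.
Qed.

Lemma nat_adherentB x y :
  nat_adherent abs x -> nat_adherent abs y -> nat_adherent abs (x - y).
Proof. by move=> hx hy; apply: nat_adherentD => //; exact: nat_adherentN. Qed.

Lemma nat_adherent_le1 x : nat_adherent abs x -> abs x <= 1.
Proof.
move=> /(_ 1 ltr01)[n /ltW hn].
by rewrite -[x](subKr n%:R) absD_le ?absN // abs_nat_le1.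
Qed.

End Padic.

(** * The powers a^x and the q-numbers for x in Z_p *)

Section Power.
Context {R : realType} {C : fieldType} {abs : C -> R} {p : nat}.
Context (habs : ultrametric_abs abs) (p_prime : prime p).
Context (abs_p : abs p%:R = p%:R^-1).
Context (complete : forall u : nat -> C, acauchy abs u -> exists l, acvg abs u l).

Lemma absBM_lt u v u' v' e : abs u <= 1 -> abs v' <= 1 ->
  abs (u - u') < e -> abs (v - v') < e -> abs (u * v - u' * v') < e.
Proof.
move=> u1 v1 hu hv; have -> : u * v - u' * v' = u * (v - v') + (u - u') * v' by ring.
apply: absD_lt; rewrite // absM //.
  by apply: le_lt_trans hv; rewrite ler_piMl ?abs_ge0.
by apply: le_lt_trans hu; rewrite ler_piMr ?abs_ge0.
Qed.

(** The cofactor of [a - 1] in [a ^+ p - 1] is a sum of [p] powers of [a], each within [abs (a - 1)]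
    of 1, so it differs from [p] by at most [abs (a - 1)]. *)
Lemma abs_subXp_le a : abs (a - 1) < 1 ->
  abs (a ^+ p - 1) <= abs (a - 1) * Order.max (abs (a - 1)) (abs p%:R).
Proof.
move=> ha; rewrite subrX1 absM // ler_wpM2l ?abs_ge0 //.
have -> : \sum_(i < p) a ^+ i = \sum_(i < p) (a ^+ i - 1) + p%:R.
  by rewrite sumrB sumr_const card_ord subrK.
rewrite absD_le ?le_max ?lexx ?orbT // abs_sum_le // ?le_max ?abs_ge0 // => i _.
by rewrite abs_subX1_le.
Qed.

(** Each raising to the power [p] shrinks the distance to 1 by at least the factor [r < 1], which
    gives geometric decay. *)
Lemma abs_subXpX_lt a e : abs (a - 1) < 1 -> 0 < e ->
  exists N, forall n, (N <= n)%N -> abs (a ^+ (p ^ n) - 1) < e.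
Proof.
move=> ha e0; set r := Order.max (abs (a - 1)) (abs p%:R).
have r0 : 0 <= r by rewrite le_max abs_ge0.
have r1 : r < 1 by rewrite gt_max ha abs_p_lt1.
have hr n : abs (a ^+ (p ^ n) - 1) <= r ^+ n.
  elim: n => [|n IH]; first by rewrite expr0 ltW.
  have h : abs (a ^+ (p ^ n) - 1) <= abs (a - 1) by exact: abs_subX1_le.
  rewrite expnSr exprM exprSr.
  apply: le_trans (abs_subXp_le (le_lt_trans h ha)) _.
  apply: ler_pM => //; first exact: abs_ge0.
    by rewrite le_max abs_ge0.
  by rewrite /r ge_max !le_max h lexx orbT.
have /cvgr0Pnorm_lt /(_ e e0) [N _ hN] : ((r ^+ n) @[n --> \oo] --> 0)%classic.
  by apply: cvg_expr; rewrite ger0_norm.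
exists N => n /hN; rewrite /= ger0_norm ?exprn_ge0 //.
exact: le_lt_trans.
Qed.

(** Exponents closer than [abs (p ^ N)%:R] differ by a multiple of [p ^ N], and every power of
    [a ^+ (p ^ N)] is as close to 1 as [a ^+ (p ^ N)] itself. *)
Lemma exp_unif_continuous a e : abs (a - 1) < 1 -> 0 < e ->
  exists2 d, 0 < d & forall n m : nat, abs (n%:R - m%:R) < d -> abs (a ^+ n - a ^+ m) < e.
Proof.
move=> ha e0; have [N /(_ N (leqnn N)) hN] := abs_subXpX_lt ha e0.
exists (abs (p ^ N)%:R); first by rewrite (abs_nat_gt0 habs p_prime abs_p) ?expn_gt0 ?prime_gt0.
move=> n m; wlog le_mn : n m / (m <= n)%N.
  move=> h nm; have [|/ltnW] := leqP m n => le_mn; first exact: h.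
  by rewrite absB //; apply: h => //; rewrite absB.
rewrite -natrB // => /(dvd_of_abs_lt habs p_prime abs_p)/dvdnP[k hk].
have -> : a ^+ n - a ^+ m = (a ^+ (p ^ N) ^+ k - 1) * a ^+ m.
  by rewrite -exprM mulnC -hk mulrBl -exprD subnK ?mul1r.
rewrite absM // absX // (abs_eq1 habs ha) expr1n mulr1.
apply: le_lt_trans hN; apply: abs_subX1_le => //.
exact: le_lt_trans (abs_subX1_le habs _ ha) ha.
Qed.

(** The value selected by [apow] exists: along naturals [u k] tending to [x], the powers [a ^+ u k]
    form a Cauchy sequence by uniform continuity, and completeness gives the limit. *)
Lemma apowP a x : abs (a - 1) < 1 -> nat_adherent abs x ->
  forall e, 0 < e -> exists2 d, 0 < d &
    forall n, abs (n%:R - x) < d -> abs (a ^+ n - apow abs a x) < e.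
Proof.
move=> ha hx; apply: (@xgetPex _ 0 [set l | forall e : R, 0 < e -> exists2 d : R, 0 < d &
    forall n : nat, abs (n%:R - x) < d -> abs (a ^+ n - l) < e]%classic).
have p0 k : 0 < abs (p ^ k)%:R by rewrite (abs_nat_gt0 habs p_prime abs_p) ?expn_gt0 ?prime_gt0.
have [u hu] := choice (fun k => hx _ (p0 k)).
have [l /acvgP - /(_ habs) hl] : exists l, acvg abs (fun k => a ^+ u k) l.
  apply: complete => e e0; have [d d0 hd] := exp_unif_continuous ha e0.
  have [N hN] := abs_pX_lt habs p_prime abs_p d0.
  exists N => m n /hN hm /hN hn; apply: hd.
  apply: (@abs_dist_lt _ _ _ habs x); first exact: lt_trans (hu m) hm.
  by rewrite absB //; exact: lt_trans (hu n) hn.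
exists l => e e0; have [d d0 hd] := exp_unif_continuous ha e0.
exists d => // n hn; have [N hN] := abs_pX_lt habs p_prime abs_p d0.
have [M hM] := hl _ e0; set k := maxn N M.
apply: (@abs_dist_lt _ _ _ habs (a ^+ u k)); last by rewrite hM // leq_maxr.
apply: hd; apply: (@abs_dist_lt _ _ _ habs x); first exact: hn.
by rewrite absB //; apply: lt_trans (hu k) (hN _ (leq_maxl _ _)).
Qed.

(** One natural number serves for both [x] and [apow abs a x]; this transfers identities and bounds
    from natural exponents to exponents in Z_p. *)
Lemma apow_approx a x d e : abs (a - 1) < 1 -> nat_adherent abs x -> 0 < d -> 0 < e ->
  exists2 n : nat, abs (n%:R - x) < d & abs (a ^+ n - apow abs a x) < e.
Proof.
move=> ha hx d0 e0; have [d' d'0 hd'] := apowP ha hx e0.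
have m0 : 0 < Order.min d d' by rewrite lt_min d0.
have [n] := hx _ m0; rewrite lt_min => /andP[nd nd'].
by exists n => //; exact: hd'.
Qed.

Lemma apow_nat a n : abs (a - 1) < 1 -> apow abs a n%:R = a ^+ n.
Proof.
move=> ha; apply/esym/eqP; rewrite -subr_eq0; apply/eqP; apply: (abs_lt_eq0 habs) => e e0.
have [d d0 hd] := apowP ha (nat_adherent_nat habs n) e0.
by apply: hd; rewrite subrr abs0.
Qed.

Lemma apow1 x : nat_adherent abs x -> apow abs 1 x = 1.
Proof.
move=> hx; have ha : abs (1 - 1) < 1 by rewrite subrr abs0.
apply/esym/eqP; rewrite -subr_eq0; apply/eqP; apply: (abs_lt_eq0 habs) => e e0.
by have [n _] := apow_approx ha hx ltr01 e0; rewrite expr1n.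
Qed.

Lemma abs_apow_sub1_le a x : abs (a - 1) < 1 -> nat_adherent abs x ->
  abs (apow abs a x - 1) <= abs (a - 1).
Proof.
(* For [a != 1], the number [abs (a - 1)] is positive and can itself be the tolerance. *)
move=> ha hx; have [->|a1] := eqVneq a 1; first by rewrite apow1.
have h : 0 < abs (a - 1) by rewrite abs_gt0 // subr_eq0.
have [n _ hn] := apow_approx ha hx ltr01 h.
by rewrite -(subrKA (a ^+ n)) absD_le ?abs_subX1_le // absB ?ltW.
Qed.

Lemma abs_apow a x : abs (a - 1) < 1 -> nat_adherent abs x -> abs (apow abs a x) = 1.
Proof. by move=> ha hx; apply: abs_eq1 => //; exact: le_lt_trans (abs_apow_sub1_le ha hx) ha. Qed.

Lemma apowD a x y : abs (a - 1) < 1 -> nat_adherent abs x -> nat_adherent abs y ->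
  apow abs a (x + y) = apow abs a x * apow abs a y.
Proof.
move=> ha hx hy; apply/esym/eqP; rewrite -subr_eq0; apply/eqP.
apply: (abs_lt_eq0 habs) => e e0.
have [d d0 hd] := apowP ha (nat_adherentD habs hx hy) e0.
have [n nx hn] := apow_approx ha hx d0 e0.
have [m my hm] := apow_approx ha hy d0 e0.
apply: (@abs_dist_lt _ _ _ habs (a ^+ (n + m))); last first.
  by apply: hd; rewrite natrD opprD addrACA absD_lt.
rewrite absB // exprD absBM_lt ?abs_apow ?absX_le1 //.
by rewrite (abs_eq1 habs ha).
Qed.

Lemma apowN a x : abs (a - 1) < 1 -> nat_adherent abs x ->
  apow abs a (- x) * apow abs a x = 1.
Proof.
move=> ha hx; have hNx := nat_adherentN habs p_prime abs_p hx.
by rewrite -apowD // addNr -[0]/(0%:R) apow_nat ?expr0.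
Qed.

(** Both sides are inverse to [apow abs a x]; for the left one this is the limit of
    [a^-1 ^+ n * a ^+ n = 1] as [n] tends to [x]. *)
Lemma apowV a x : abs (a - 1) < 1 -> nat_adherent abs x ->
  apow abs a^-1 x = apow abs a (- x).
Proof.
move=> ha hx; have hV : abs (a^-1 - 1) < 1 by rewrite abs_subV1.
have A0 : apow abs a x != 0 by rewrite -(abs_gt0 habs) abs_apow.
have a0 : a != 0 by rewrite -(abs_gt0 habs) (abs_eq1 habs ha).
apply: (mulIf A0); rewrite apowN //.
apply/esym/eqP; rewrite -subr_eq0; apply/eqP; apply: (abs_lt_eq0 habs) => e e0.
have [d d0 hd] := apowP ha hx e0.
have [n nx hn] := apow_approx hV hx d0 e0.
have -> : 1 = a^-1 ^+ n * a ^+ n by rewrite -exprMn mulVf ?expr1n.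
by rewrite absBM_lt ?hd ?abs_apow ?absX_le1 ?(abs_eq1 habs hV).
Qed.

Lemma abs_qnum_le1 a x : abs (a - 1) < 1 -> nat_adherent abs x -> abs (qnum abs a x) <= 1.
Proof.
move=> ha hx; rewrite /qnum; case: eqVneq => [_|a1]; first exact: nat_adherent_le1.
have h : 0 < abs (1 - a) by rewrite abs_gt0 // subr_eq0 eq_sym.
rewrite absM // absV // ler_pdivrMr // mul1r ![abs (1 - _)]absB //.
exact: abs_apow_sub1_le.
Qed.

Lemma qnumD a x y : abs (a - 1) < 1 -> nat_adherent abs x -> nat_adherent abs y ->
  qnum abs a (x + y) = qnum abs a x + apow abs a x * qnum abs a y.
Proof.
move=> ha hx hy; rewrite /qnum; case: eqVneq => [->|a1]; first by rewrite apow1 ?mul1r.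
by rewrite apowD // mulrA -mulrDl mulrBr mulr1 subrKA.
Qed.

Lemma qnumV a x : abs (a - 1) < 1 -> nat_adherent abs x ->
  qnum abs a^-1 x = - a * qnum abs a (- x).
Proof.
move=> ha hx; rewrite /qnum invr_eq1; case: eqVneq => [->|a1].
  by rewrite mulN1r opprK.
have a0 : a != 0 by rewrite -(abs_gt0 habs) (abs_eq1 habs ha).
rewrite apowV //; field; rewrite a0 !subr_eq0 a1 eq_sym a1 //.
Qed.

Lemma qnum_pX_lt a e : abs (a - 1) < 1 -> 0 < e ->
  exists N, forall n, (N <= n)%N -> abs (qnum abs a (p ^ n)%:R) < e.
Proof.
move=> ha e0; rewrite /qnum; case: eqVneq => [_|a1].
  exact: (abs_pX_lt habs p_prime abs_p).
have h : 0 < abs (1 - a) by rewrite abs_gt0 // subr_eq0 eq_sym.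
have [N hN] := abs_subXpX_lt ha (mulr_gt0 e0 h).
exists N => n /hN hn; rewrite apow_nat // absM // absV // ltr_pdivrMr //.
by rewrite absB.
Qed.

End Power.

(** * Alternating sums of powers of q-numbers and the fermionic integral *)

Section Genocchi.
Context {R : realType} {C : fieldType} {abs : C -> R} {p : nat}.
Context (habs : ultrametric_abs abs) (p_prime : prime p) (p_odd : odd p).
Context (abs_p : abs p%:R = p%:R^-1).
Context (complete : forall u : nat -> C, acauchy abs u -> exists l, acvg abs u l).

Definition alternating_qsum a n x (P : nat) : C :=
  \sum_(0 <= k < P) (-1) ^+ k * qnum abs a (x + k%:R) ^+ n.

(* The weight [q ^ (- beta xi)] cancels the density [q ^ (beta xi)] of the
   fermionic measure. *)
Lemma genocchiE q alpha beta n x : abs (q - 1) < 1 ->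
  genocchi abs p q alpha beta n.+1 x = n.+1%:R * alim abs (fun N =>
    (qnumn (- q ^+ beta) (p ^ N))^-1 * alternating_qsum (q ^+ alpha) n x (p ^ N)).
Proof.
move=> hq; rewrite /genocchi /fermionic_int; congr (_ * alim _ _).
apply/funext => N; congr (_ * _); apply: eq_bigr => k _.
have := apowN habs p_prime abs_p complete hq (nat_adherent_nat habs (beta * k)).
rewrite (apow_nat habs p_prime abs_p complete) // natrM exprM mulrC => h.
by rewrite mulrA h mul1r mulrC.
Qed.

(* Substituting [k |-> P - 1 - k], which preserves the signs for odd [P]. *)
Lemma alternating_qsum_reflect a n x P : abs (a - 1) < 1 -> nat_adherent abs x -> odd P ->
  alternating_qsum a^-1 n (1 - x) P = (- a) ^+ n * alternating_qsum a n (x - P%:R) P.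
Proof.
move=> ha hx oP; rewrite /alternating_qsum [in RHS]big_nat_rev mulr_sumr.
apply: eq_big_nat => k /= kP; rewrite add0n.
have hk : nat_adherent abs (1 - x + k%:R).
  apply: nat_adherentD; [by []| |exact: nat_adherent_nat].
  apply: (nat_adherentB habs p_prime abs_p) => //.
  exact: (nat_adherent_nat habs 1).
rewrite (qnumV habs p_prime abs_p complete ha hk) exprMn mulrCA; congr (_ * (_ * _ ^+ _)).
  by rewrite -signr_odd -[in RHS]signr_odd oddB // oP /= negbK.
(* The arguments agree: -(1 - x + k) = (x - P) + (P - 1 - k). *)
by congr qnum; rewrite natrB // -natr1; ring.
Qed.

Lemma abs_alternating_qsum_le1 a n x P : abs (a - 1) < 1 -> nat_adherent abs x ->
  abs (alternating_qsum a n x P) <= 1.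
Proof.
move=> ha hx; apply: abs_sum_le => // k _; rewrite abs_sign // absX_le1 //.
apply: (abs_qnum_le1 habs p_prime abs_p complete) => //.
by apply: nat_adherentD => //; exact: nat_adherent_nat.
Qed.

(** Termwise, [[y + P]_a - [y]_a] equals [a^y [P]_a], whose absolute value is that of [[P]_a] and
    tends to 0. Taking n-th powers and summing do not enlarge the bound, whatever the number of
    terms. *)
Lemma alternating_qsum_shift_lt a n x e : abs (a - 1) < 1 -> nat_adherent abs x -> 0 < e ->
  exists N, forall m, (N <= m)%N ->
    abs (alternating_qsum a n (x - (p ^ m)%:R) (p ^ m) - alternating_qsum a n x (p ^ m)) < e.
Proof.
move=> ha hx e0; have [N hN] := qnum_pX_lt habs p_prime abs_p complete ha e0.
exists N => m /hN hm; apply: le_lt_trans hm.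
rewrite -sumrB; apply: abs_sum_le => [//||k _]; first exact: abs_ge0.
set P := (p ^ m)%:R; set y := x - P + k%:R.
have hP : nat_adherent abs P by exact: nat_adherent_nat.
have hy : nat_adherent abs y.
  apply: nat_adherentD; [by []| |exact: nat_adherent_nat].
  exact: (nat_adherentB habs p_prime abs_p).
have hyP : nat_adherent abs (y + P) by exact: nat_adherentD.
have -> : x + k%:R = y + P by rewrite /y; ring.
rewrite -mulrBr abs_sign //.
apply: (le_trans (abs_subXX_le habs n _ _)).
- exact: (abs_qnum_le1 habs p_prime abs_p complete).
- exact: (abs_qnum_le1 habs p_prime abs_p complete).
rewrite absB // (qnumD habs p_prime abs_p complete) // [_ + _ * _]addrC addrK absM //.
by rewrite (abs_apow habs p_prime abs_p complete) ?mul1r.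
Qed.

(** Otherwise [2 = (1 + a) - (a - 1)] would have absolute value below 1, although [p] is odd. Hence
    numerator and denominator of the q-number of [p ^ N] at base [- q ^+ beta] are units. *)
Lemma abs_1D a : abs (a - 1) < 1 -> abs (1 + a) = 1.
Proof.
move=> ha; apply/le_anti; rewrite absD_le ?abs1 ?(abs_eq1 habs ha) //= leNgt.
apply/negP => h; have : abs (1 + a - (a - 1)) < 1 by rewrite absD_lt ?absN.
have -> : 1 + a - (a - 1) = 2%:R by ring.
by rewrite (abs_coprime habs p_prime abs_p) ?ltxx // coprimen2.
Qed.

End Genocchi.

Unset Implicit Arguments.

Theorem theorem2 (R : realType) (p : nat) (p_prime : prime p) (p_odd : odd p)
    (C : fieldType) (abs : C -> R) (C_is_Cp : is_Cp abs p)
    (q : C) (hq : abs (q - 1) < 1)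
    (alpha beta n : nat) (x : C) (hx : padic_int abs x) :
  genocchi abs p q^-1 alpha beta n.+1 (1 - x) =
  (-1) ^+ n * q ^ ((alpha * n)%N%:Z - beta%:Z) *
    genocchi abs p q alpha beta n.+1 x.
Proof.
case: C_is_Cp => habs abs_p complete _ _.
have {}hx := padic_int_nat_adherent habs p_prime abs_p hx.
have q0 : q != 0 by rewrite -(abs_gt0 habs) (abs_eq1 habs hq).
rewrite !(genocchiE habs p_prime abs_p complete) ?abs_subV1 // mulrCA; congr (_ * _).
have -> : q ^ ((alpha * n)%N%:Z - beta%:Z) = q ^+ alpha ^+ n / q ^+ beta.
  by rewrite expfzDr // -exprnN -exprnP exprM.
rewrite !exprVn; set a := q ^+ alpha; set Q := q ^+ beta.
have ha : abs (a - 1) < 1 by exact: le_lt_trans (abs_subX1_le habs _ hq) hq.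
have hQ : abs (Q - 1) < 1 by exact: le_lt_trans (abs_subX1_le habs _ hq) hq.
have a0 : a != 0 by rewrite expf_neq0.
have Q0 : Q != 0 by rewrite expf_neq0.
(* The scaling constant is [(-1) ^+ n * (a ^+ n / Q)]; the rest shows that the difference of the two
   sequences is null. *)
apply: alim_scale => //.
  by rewrite !mulf_neq0 ?invr_eq0 ?expf_neq0 ?oppr_eq0 ?oner_eq0.
apply/(acvgP habs) => e e0.
have [N hN] := abs_subXpX_lt habs p_prime abs_p hQ e0.
have [M hM] := alternating_qsum_shift_lt habs p_prime abs_p complete n ha hx e0.
exists (maxn N M) => m; rewrite geq_max subr0 => /andP[/hN {}hN /hM {}hM].
have oP : odd (p ^ m) by rewrite oddX p_odd orbT.
rewrite (alternating_qsum_reflect habs p_prime abs_p complete) //.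
set P := (p ^ m)%N in hN hM oP *; set T := alternating_qsum a n _ P in hM *.
set S := alternating_qsum a n x P in hM *.
have QP1 : abs (1 + Q ^+ P) = 1.
  by apply: (abs_1D habs p_prime p_odd abs_p); exact: le_lt_trans (abs_subX1_le habs _ hQ) hQ.
have Q1 : abs (1 + Q) = 1 by exact: (abs_1D habs p_prime p_odd abs_p).
have QP1n : 1 + Q ^+ P != 0 by rewrite -(abs_gt0 habs) QP1.
have Q1n : 1 + Q != 0 by rewrite -(abs_gt0 habs) Q1.
(* As [P] is odd, [qnumn (- Q) P] is [(1 + Q ^+ P) / (1 + Q)]; replacing [Q] by [Q^-1] multiplies
   its inverse by [Q ^+ P / Q]. The common factor has absolute value 1. *)
have -> : (qnumn (- Q^-1) P)^-1 * ((- a) ^+ n * T)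
    - (-1) ^+ n * (a ^+ n / Q) * ((qnumn (- Q) P)^-1 * S)
  = (-1) ^+ n * (a ^+ n / Q * (1 + Q) / (1 + Q ^+ P) * (Q ^+ P * T - S)).
  have oN (b : C) : (- b) ^+ P = - b ^+ P by rewrite exprNn -signr_odd oP mulN1r.
  rewrite /qnumn !oN !opprK exprVn [(- a) ^+ n]exprNn.
  by field; rewrite Q0 expf_neq0 //= QP1n Q1n.
rewrite abs_sign // absM //.
have -> : abs (a ^+ n / Q * (1 + Q) / (1 + Q ^+ P)) = 1.
  rewrite !(absM habs) !(absV habs) QP1 Q1 absX // (abs_eq1 habs ha) (abs_eq1 habs hQ).
  by rewrite expr1n !invr1 !mulr1.
have T1 : abs T <= 1.
  apply: (abs_alternating_qsum_le1 habs p_prime abs_p complete) => //.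
  by apply: (nat_adherentB habs p_prime abs_p) => //; exact: nat_adherent_nat.
(* The first error is small because [Q ^+ P] tends to 1 and [T] is bounded, the second by the shift
   estimate. *)
have -> : Q ^+ P * T - S = (Q ^+ P - 1) * T + (T - S) by ring.
rewrite mul1r absD_lt //; apply: le_lt_trans hN.
by rewrite absM // ler_piMr ?abs_ge0.
Qed.
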